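(* Let $K$ be a number field and assume that the ABC conjecture holds over $K$. Let $\eta \in \mathcal{O}_K^{*}$ be a unit such that $|\sigma(\eta)|<1$ for all but exactly one embedding $\sigma: K \to \mathbb{C}$, and such that $|\sigma_0(\eta)|>1$ for the one exceptional embedding $\sigma_0$. Then there are infinitely many prime ideals of $\mathcal{O}_K$ that are non-Wieferich with respect to $\eta$.
   Context: $\mathcal{O}_K$ is the ring of integers of $K$ and $N(I)=[\mathcal{O}_K:I]$ is the absolute norm of a nonzero ideal $I$. Non-Wieferich primes: a nonzero prime ideal $\pi$ of $\mathcal{O}_K$ is non-Wieferich with respect to a unit $\eta$ if $\eta^{N(\pi)-1}\equiv 1 \pmod{\pi}$ and $\eta^{N(\pi)-1}\not\equiv 1 \pmod{\pi^2}$. ABC conjecture over $K$: let $M_K$ be the set of places of $K$, with $\|\alpha\|_{\mathfrak p}=N(\mathfrak p)^{-v_{\mathfrak p}(\alpha)}$ at a finite place $\mathfrak p$, and with the usual normalized absolute values at archimedean places ($|\sigma(\alpha)|$ for a real place, $|\sigma(\alpha)|^2$ for a complex place). Put $$H(a,b,c)=\Big(\prod_{v\in M_K}\max\{\|a\|_v,\|b\|_v,\|c\|_v\}\Big)^{1/[K:\mathbb{Q}]},\qquad \mathrm{rad}(\alpha)=\Big(\prod_{\mathfrak p\mid \alpha}N(\mathfrak p)^{v_{\mathfrak p}(p)}\Big)^{1/[K:\mathbb{Q}]}$$ for nonzero $\alpha\in\mathcal{O}_K$, where the product runs over prime ideals $\mathfrak p$ of $\mathcal{O}_K$ dividing $\alpha$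 and $p$ is the rational prime below $\mathfrak p$. The ABC conjecture over $K$ states: for every $\epsilon>0$ there is a constant $C_{\epsilon,K}$ such that $H(a,b,c)\le C_{\epsilon,K}\,\mathrm{rad}(abc)^{1+\epsilon}$ for all nonzero $a,b,c\in\mathcal{O}_K$ with $a+b+c=0$. *)

(* Defs.v *)
From HB Require Import structures.
From mathcomp Require Import all_boot all_order all_algebra all_field.
From mathcomp Require Import ring_quotient complex.
From mathcomp Require Import boolp classical_sets functions cardinality fsbigop.
From mathcomp Require Import reals exp.
From mathcomp Require Import finmap.

Set Implicit Arguments.
Unset Strict Implicit.
Unset Printing Implicit Defensive.

Import Order.TTheory GRing.Theory Num.Theory.
Import ComplexField.Normc.

Local Open Scope classical_set_scope.
Local Open Scope ring_scope.

Definition algebraic_integer (K : fieldExtType rat) : {pred K} :=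
  [pred x | `[< integralOver (intr : int -> K) x >]].
Arguments algebraic_integer : clear implicits.

Fact algebraic_integer_subring (K : fieldExtType rat) :
  subring_closed (algebraic_integer K).
Proof.
split=> [|x y|x y]; rewrite ?inE; first exact/asboolP/integral1.
  by move=> /asboolP xI /asboolP yI; apply/asboolP; exact: integral_sub.
by move=> /asboolP xI /asboolP yI; apply/asboolP; exact: integral_mul.
Qed.

HB.instance Definition _ (K : fieldExtType rat) :=
  GRing.isSubringClosed.Build K (algebraic_integer K)
    (algebraic_integer_subring K).

Record ring_of_integers (K : fieldExtType rat) := RingOfIntegers {
  integer_val : K;
  integer_valP : integer_val \in algebraic_integer K
}.

HB.instance Definition _ (K : fieldExtType rat) :=
  [isSub for @integer_val K].
HB.instance Definition _ (K : fieldExtType rat) :=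
  [Choice of ring_of_integers K by <:].
HB.instance Definition _ (K : fieldExtType rat) :=
  [SubChoice_isSubComNzRing of ring_of_integers K by <:].

Section Units.
Variable K : fieldExtType rat.
Local Notation OK := (ring_of_integers K).

Definition integer_unit : {pred OK} :=
  [pred x | (val x != 0) && ((val x)^-1 \in algebraic_integer K)].
Definition integer_inv (x : OK) : OK := insubd x (val x)^-1.

Fact integer_mulVr : {in integer_unit, left_inverse 1 integer_inv *%R}.
Proof.
move=> x /andP[x0 xV]; apply: val_inj.
have -> : \val (integer_inv x * x) = \val (integer_inv x) * \val x by [].
by rewrite val_insubd xV mulVf.
Qed.

Fact integer_unitPl (x y : OK) : y * x = 1 -> x \in integer_unit.
Proof.
move=> /(congr1 val) yx1; have {}yx1 : val y * val x = 1 by [].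
have x0 : val x != 0.
  by apply: contra_eqN yx1 => /eqP ->; rewrite mulr0 eq_sym oner_neq0.
rewrite inE x0 /= -[X in X \in _]mul1r -yx1 mulfK //.
exact: integer_valP.
Qed.

Fact integer_invr_out : {in [predC integer_unit], integer_inv =1 id}.
Proof.
move=> x; rewrite inE negb_and negbK => /orP[/eqP x0|/negPf xV]; apply: val_inj.
  by rewrite val_insubd x0 invr0 if_same.
by rewrite val_insubd xV.
Qed.

End Units.

HB.instance Definition _ (K : fieldExtType rat) :=
  GRing.ComNzRing_hasMulInverse.Build (ring_of_integers K)
    (@integer_mulVr K) (@integer_unitPl K) (@integer_invr_out K).

Fact integer_idomain (K : fieldExtType rat) (x y : ring_of_integers K) :
  x * y = 0 -> (x == 0) || (y == 0).
Proof.
move=> /(congr1 val) xy0; have /eqP : val x * val y = 0 by [].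
rewrite mulf_eq0.
by case/orP=> /eqP z; apply/orP; [left|right]; apply/eqP/val_inj.
Qed.

HB.instance Definition _ (K : fieldExtType rat) :=
  GRing.ComUnitRing_isIntegral.Build (ring_of_integers K)
    (@integer_idomain K).

Section Ideals.
Variable A : comNzRingType.
Implicit Types (I J P : set A) (x y : A).

(* [idealr_closed] includes [1 \notin P]. *)
Definition nonzero_prime_ideal P : Prop :=
  [/\ idealr_closed [in P], prime_idealr_closed [in P] & P <> [set 0]].

Definition ideal_mul I J : set A :=
  [set x | exists2 s : seq (A * A),
     (forall u, u \in s -> I u.1 /\ J u.2) & x = \sum_(u <- s) u.1 * u.2].

Definition ideal_exp I (n : nat) : set A := iter n (ideal_mul I) setT.

Definition ideal_cosets I : set (set A) :=
  range (fun x => [set y | y - x \in I]).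

(* [A : I], with value 0 when the index is infinite. *)
Definition ideal_norm I : nat := #|` fset_set (ideal_cosets I)|%fset.

(* The exponent of P in the factorisation of (x); meaningful for x != 0. *)
Definition valuation P x : nat :=
  xget 0%N [set n | x \in ideal_exp P n /\ x \notin ideal_exp P n.+1].

Definition prime_below P : nat :=
  xget 0%N [set p : nat | prime p /\ p%:R \in P].

Definition non_wieferich (eta : A) P : Prop :=
  eta ^+ (ideal_norm P).-1 - 1 \in P /\
  eta ^+ (ideal_norm P).-1 - 1 \notin ideal_exp P 2.

End Ideals.

Section ABC.
Variables (R : realType) (K : fieldExtType rat).
Local Notation OK := (ring_of_integers K).

(* An archimedean place is a class {sigma, conj sigma} of embeddings. *)
Definition archimedean_place (w : set (K -> R[i])) : Prop :=
  exists sigma : {rmorphism K -> R[i]},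
    w = [set (sigma : K -> R[i]); fun x => conjc (sigma x)].

(* inl: finite places, as nonzero prime ideals; inr: archimedean places. *)
Definition places : set (set OK + set (K -> R[i])) :=
  [set v | match v with
           | inl P => nonzero_prime_ideal P
           | inr w => archimedean_place w
           end].

Definition finite_abs (P : set OK) (x : OK) : R :=
  if x == 0 then 0 else (ideal_norm P)%:R ^- valuation P x.

(* The value does not depend on which member of the class is chosen. *)
Definition archimedean_abs (w : set (K -> R[i])) (x : OK) : R :=
  let sigma := xget (fun=> 0) w in
  if `[< forall y, complex.Im (sigma y) = 0 >]
  then normc (sigma (val x))
  else normc (sigma (val x)) ^+ 2.

Definition place_abs (v : set OK + set (K -> R[i])) (x : OK) : R :=
  match v with
  | inl P => finite_abs P x
  | inr w => archimedean_abs w x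
  end.

(* For (a, b, c) != 0 only finitely many factors differ from 1, so the
   finitely supported product is the product over all places. *)
Definition height (a b c : OK) : R :=
  (\big[*%R/1]_(v \in places)
     Num.max (place_abs v a) (Num.max (place_abs v b) (place_abs v c)))
  `^ (\dim {:K})%:R^-1.

Definition radical (x : OK) : R :=
  (\big[*%R/1]_(P \in [set P : set OK | nonzero_prime_ideal P /\ x \in P])
     ((ideal_norm P)%:R : R) ^+ valuation P (prime_below P)%:R)
  `^ (\dim {:K})%:R^-1.

Definition abc_conjecture : Prop :=
  forall eps : R, 0 < eps -> exists C : R, forall a b c : OK,
    a != 0 -> b != 0 -> c != 0 -> a + b + c = 0 ->
    height a b c <= C * radical (a * b * c) `^ (1 + eps).

End ABC.

(* Main.v *)
(** Apply abc to [eta^n - 1 + 1 - eta^n = 0].  The height to the power [K : Q]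
    is at least [|sigma0 eta|^n].  If only finitely many primes were
    non-Wieferich, then all primes [P] dividing [eta^n - 1] outside a finite set
    would be unramified with [P^2 | eta^n - 1], so the product of their norms is
    [O(|N(eta^n - 1)|^(1/2)) = O(|sigma0 eta|^(n/2))], all the other conjugates
    of [eta] being small.  Taking [epsilon = 1/2], this bounds [|sigma0 eta|^n].

    No factorization of ideals is needed.  The index [O : aO] is bounded, up to
    a constant, by [|N a|] through the Smith normal form of multiplication by
    [a] on a lattice [Z[theta]]; finiteness of the set of ramified primes comes
    from [O / pO] being reduced when [p] does not divide a multiple of the
    determinant of the matrix of conjugates of the powers of [theta]. *)

Require Import Defs.
From HB Require Import structures.
From mathcomp Require Import all_boot all_order all_algebra all_field.
From mathcomp Require Import ring_quotient complex.
From mathcomp Require Import finmap.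
From mathcomp Require Import boolp classical_sets functions cardinality fsbigop.
From mathcomp Require Import reals exp.
From mathcomp Require Import zify ring lra.
Set Implicit Arguments.
Unset Strict Implicit.
Unset Printing Implicit Defensive.
Import Order.TTheory GRing.Theory Num.Theory.
Import ComplexField.Normc.
Local Open Scope classical_set_scope.
Local Open Scope ring_scope.

(** * Integral elements and nilpotence modulo a prime *)

(** Stated over any ring so that it applies both to [K] and to the fields into which [K] embeds;
    over [K] it is convertible to [algebraic_integer]. *)
Definition integral_elements (F : comNzRingType) : {pred F} :=
  [pred x | `[< integralOver (intr : int -> F) x >]].
Arguments integral_elements : clear implicits.

Fact integral_elements_subring (F : comNzRingType) :
  subring_closed (integral_elements F).
Proof.
by split=> [|x y|x y]; rewrite ?inE;
   [exact: integral1 | exact: integral_sub | exact: integral_mul].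
Qed.

HB.instance Definition _ (F : comNzRingType) :=
  GRing.isSubringClosed.Build F (integral_elements F)
    (integral_elements_subring F).

Lemma integral_morph (E F : comNzRingType) (f : {rmorphism E -> F}) x :
  x \in integral_elements E -> f x \in integral_elements F.
Proof.
rewrite !inE => -[p pm /rootP px]; exists p => //.
have -> : map_poly (intr : int -> F) p = map_poly f (map_poly intr p).
  by rewrite -map_poly_comp; apply: eq_map_poly => z /=; rewrite rmorph_int.
by apply/rootP; rewrite horner_map px rmorph0.
Qed.

Lemma integral_morph_inj (E F : fieldType) (f : {rmorphism E -> F}) x :
  f x \in integral_elements F -> x \in integral_elements E.
Proof.
rewrite !inE => -[p pm px]; exists p => //.
move: px; have -> : map_poly (intr : int -> F) p = map_poly f (map_poly intr p).
  by rewrite -map_poly_comp; apply: eq_map_poly => z /=; rewrite rmorph_int.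
by rewrite fmorph_root.
Qed.

(** Integrality descends to [rat] along an injective morphism; the rational is then viewed in
    [algC], where a rational algebraic integer is an integer. *)
Lemma integral_rat_int (F : numFieldType) (q : rat) :
  ratr q \in integral_elements F -> exists z : int, q = z%:~R.
Proof.
move=> /integral_morph_inj; rewrite inE => -[p pm px].
have : (ratr q : algC) \in Num.int.
  apply: Cint_rat_Aint; first exact: Crat_rat.
  apply: (@root_monic_Aint (map_poly intr p)).
  - have -> : map_poly (intr : int -> algC) p = map_poly ratr (map_poly intr p).
      by rewrite -map_poly_comp; apply: eq_map_poly => z /=; rewrite rmorph_int.
    by rewrite fmorph_root.
  - exact: monic_map.
  - by apply/polyOverP => i; rewrite coef_map; exact: intr_int.
case/intrP=> z zE; exists z.
by apply: (fmorph_inj (ratr : rat -> algC)); rewrite rmorph_int.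
Qed.

(** Writing a monic equation as [p = q * 'X + p0] gives [x * q(x) = - p0]. A zero constant term is
    first removed by dividing by ['X], which is possible since [x] is nonzero. *)
Lemma integral_dvd_int (F : numFieldType) (x : F) :
  x \in integral_elements F -> x != 0 ->
  exists2 D : int, D != 0 & exists2 u, u \in integral_elements F & x * u = D%:~R.
Proof.
rewrite inE => -[p pm]; have := monic_neq0 pm.
move: {2}(size p) (leqnn (size p)) => n; elim: n p pm => [|n IHn] p pm.
  by rewrite leqn0 size_poly_eq0 => ->.
move=> sz p0 px x0; have [p00|p00] := eqVneq p`_0 0.
  have /factor_theorem[q qE] : root p 0 by rewrite /root horner_coef0 p00.
  rewrite subr0 in qE.
  have qm : q \is monic by rewrite monicE -(lead_coefMX q) -qE -monicE.
  apply: (IHn q) => //; last 2 first.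
  - exact: monic_neq0.
  - move: px; rewrite qE rmorphM /= map_polyX rootM rootX (negPf x0) orbF //.
  by move: sz; rewrite qE size_mulX // monic_neq0.
exists (- p`_0); first by rewrite oppr_eq0.
have [q qE] : exists q : {poly int}, p = q * 'X + (p`_0)%:P.
  exists (\poly_(i < size p) p`_i.+1); apply/polyP=> -[|i].
    by rewrite coefD coefMX coefC /= add0r.
  rewrite coefD coefMX coefC /= addr0 coef_poly; case: ltnP => // le.
  by rewrite nth_default // ltnW.
exists (map_poly intr q).[x]; last first.
  move/rootP: px; rewrite {1}qE rmorphD rmorphM /= map_polyX map_polyC !hornerE.
  by move/eqP; rewrite addr_eq0 mulrC => /eqP ->; rewrite rmorphN.
rewrite horner_coef; apply: rpred_sum => i _; apply: rpredM; last first.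
  by apply: rpredX; rewrite inE; exists p.
by rewrite coef_map; exact: rpred_int.
Qed.

Section NilpotentMod.
Variables (F : comNzRingType) (m : F).
Local Notation O := (integral_elements F).

(** This is the radical of the ideal [m O]. Being an ideal, it passes from elements to their
    combinations with integral coefficients. *)
Definition nilpotent_mod (w : F) : Prop :=
  w \in O /\ exists k, exists2 u, u \in O & w ^+ k = m * u.

Lemma nilpotent_modM w v : v \in O -> nilpotent_mod w -> nilpotent_mod (w * v).
Proof.
move=> vO [wO [k [u uO e]]]; split; first exact: rpredM.
exists k, (u * v ^+ k); first by rewrite rpredM ?rpredX.
by rewrite exprMn e mulrA.
Qed.

(** In the binomial expansion of the power [k + l], every term contains [w ^+ k] or [v ^+ l], hence
    a factor [m]. *)
Lemma nilpotent_modD w v :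
  nilpotent_mod w -> nilpotent_mod v -> nilpotent_mod (w + v).
Proof.
move=> [wO [k [u uO e]]] [vO [l [t tO e']]]; split; first exact: rpredD.
exists (k + l)%N; rewrite exprDn.
suff [h hO ->] : exists2 h : 'I_(k + l).+1 -> F, (forall i, h i \in O) &
    \sum_(i < (k + l).+1) w ^+ (k + l - i) * v ^+ i *+ 'C(k + l, i)
    = \sum_(i < (k + l).+1) m * h i.
  by exists (\sum_i h i); [apply: rpred_sum | rewrite mulr_sumr].
suff /choice[h hP] : forall i : 'I_(k + l).+1, exists hi, hi \in O /\
    w ^+ (k + l - i) * v ^+ i *+ 'C(k + l, i) = m * hi.
  exists h => [i|]; first by case: (hP i).
  by apply: eq_bigr => i _; case: (hP i).
move=> i; have [li|il] := leqP l i.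
  exists (w ^+ (k + l - i) * t * v ^+ (i - l) *+ 'C(k + l, i)).
  split; first by rewrite rpredMn // !rpredM ?rpredX.
  have -> : v ^+ i = m * t * v ^+ (i - l) by rewrite -e' -exprD subnKC.
  by rewrite mulrnAr; congr (_ *+ _); ring.
have ki : (k + l - i = k + (l - i))%N by rewrite addnBA // ltnW.
exists (u * w ^+ (l - i) * v ^+ i *+ 'C(k + l, i)).
split; first by rewrite rpredMn // !rpredM ?rpredX.
by rewrite ki exprD e mulrnAr; congr (_ *+ _); ring.
Qed.

Lemma nilpotent_mod0 : nilpotent_mod 0.
Proof. by split; [exact: rpred0 | exists 1%N, 0; rewrite ?rpred0 // expr1 mulr0]. Qed.

End NilpotentMod.

(** The quotient [z ^+ k / p] is rational and integral, hence an integer, and a prime dividing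
    [z ^+ k] divides [z]. *)
Lemma nilpotent_mod_prime (F : numFieldType) (p : nat) (z : int) :
  prime p -> nilpotent_mod (p%:R : F) z%:~R -> (p %| `|z|)%N.
Proof.
move=> pp [_ [k [u uO e]]].
have p0 : (p%:R : F) != 0 by rewrite pnatr_eq0 -lt0n prime_gt0.
have [t tE] : exists t : int, z%:~R ^+ k / p%:R = t%:~R :> rat.
  apply: (@integral_rat_int F).
  rewrite rmorphM fmorphV rmorphXn /= rmorph_int rmorph_nat e mulrC mulKf //.
have p0' : (p%:R : rat) != 0 by rewrite pnatr_eq0 -lt0n prime_gt0.
have : z ^+ k = p%:Z * t.
  apply: (@intr_inj rat); rewrite rmorphXn rmorphM /= -tE mulrC.
  by rewrite -[X in _ * X]/(p%:R : rat) divfK.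
move/(congr1 absz); rewrite abszX abszM /= => /(congr1 (dvdn p)).
by rewrite dvdn_mulr // Euclid_dvdX // => /andP[].
Qed.

(** * Complex embeddings *)

Lemma intr_fieldExt_eq0 (K : fieldExtType rat) (z : int) :
  (z%:~R == 0 :> K) = (z == 0).
Proof.
by rewrite -[X in X == 0](rmorph_int (GRing.in_alg K)) fmorph_eq0 intr_eq0.
Qed.

Lemma fieldExt_pchar0 (K : fieldExtType rat) : [pchar K] =i pred0.
Proof.
move=> p; rewrite !inE; apply/negP => /andP[pp].
have := intr_fieldExt_eq0 K p; rewrite -[p%:~R]/(p%:R : K) => ->.
by apply/negP; rewrite -lt0n prime_gt0.
Qed.

Lemma integral_multiple (K : fieldExtType rat) (x : K) :
  exists2 m : int, m != 0 & m%:~R * x \in integral_elements K.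
Proof.
have [q qx q0] : exists2 q : {poly int}, root (map_poly intr q) x & q != 0.
  have /polyOver1P[f fE] : minPoly 1 x \is a polyOver 1%VS := minPolyOver 1%AS x.
  have [q [a a0 qE]] := rat_poly_scale f.
  have f0 : f != 0.
    apply: contraTneq (monic_minPoly 1%AS x) => f0.
    by rewrite fE f0 rmorph0 monicE lead_coef0 eq_sym oner_eq0.
  exists q; last by apply: contraNneq f0 => q0; rewrite qE q0 rmorph0 scaler0.
  have := root_minPoly 1%AS x; rewrite fE qE map_polyZ rootZ; last first.
    by rewrite fmorph_eq0 invr_eq0 intr_eq0.
  rewrite -map_poly_comp; congr (root _ _); apply: eq_map_poly => z /=.
  by rewrite -[RHS](rmorph_int (GRing.in_alg K)).
have sq : (1 < size q)%N.
  rewrite ltnNge; apply: contra q0 => /size1_polyC qE.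
  by move: qx; rewrite qE map_polyC /= rootC intr_fieldExt_eq0 => /eqP ->.
set n := (size q).-1; have qn : size q = n.+1 by rewrite prednK // ltnW.
exists (lead_coef q); first by rewrite lead_coef_eq0.
(* This is [a ^+ n.-1 * q('X / a)] for [a] the leading coefficient of [q]: it is monic with integer
   coefficients and vanishes at [a * x]. *)
rewrite inE; exists ('X^n + \poly_(i < n) (lead_coef q ^+ (n - i).-1 * q`_i)).
  by rewrite monicE lead_coefDl ?lead_coefXn // size_polyXn ltnS size_poly.
apply/rootP; rewrite rmorphD /= map_polyXn.
have -> : map_poly intr (\poly_(i < n) (lead_coef q ^+ (n - i).-1 * q`_i)) =
    \poly_(i < n) (lead_coef q ^+ (n - i).-1 * q`_i)%:~R :> {poly K}.
  by apply/polyP=> i; rewrite coef_map !coef_poly; case: ifP.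
set a : K := (lead_coef q)%:~R.
rewrite hornerD hornerXn horner_poly.
have := rootP qx; rewrite horner_coef size_map_poly_id0; last first.
  by rewrite intr_fieldExt_eq0 lead_coef_eq0.
rewrite qn big_ord_recr /= => /(congr1 ( *%R (a ^+ n.-1))).
rewrite mulr0 mulrDr mulr_sumr addrC => qe; rewrite -[RHS]qe; congr (_ + _).
  rewrite coef_map -/a -[q`_n]/(lead_coef q) exprMn mulrA -exprSr prednK //.
  by rewrite /n -ltnS prednK // ltnW.
apply: eq_bigr => i _; rewrite coef_map /= rmorphM rmorphXn /= -/a exprMn.
have -> : n.-1 = ((n - i).-1 + i)%N by case: i => i /= ; lia.
by rewrite exprD; ring.
Qed.

Section Embeddings.
Variables (F : numClosedFieldType) (K : fieldExtType rat).

Lemma rmorph_horner_alg (s : {rmorphism K -> F}) (q : {poly rat}) (x : K) :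
  s (map_poly (GRing.in_alg K) q).[x] = (map_poly ratr q).[s x].
Proof.
rewrite -horner_map -map_poly_comp; congr (_.[_]); apply: eq_map_poly => a /=.
by rewrite alg_num_field fmorph_rat.
Qed.

(** The morphism sends [p(x)] to [p(r)]. It is well defined because [p(x) = 0] forces the minimal
    polynomial of [x], which vanishes at [r], to divide [p]. *)
Lemma embedding_of_root (x : K) (f : {poly rat}) (r : F) :
  <<1; x>>%VS = fullv -> minPoly 1 x = map_poly (GRing.in_alg K) f ->
  root (map_poly ratr f) r -> exists s : {rmorphism K -> F}, s x = r.
Proof.
move=> gx fE fr.
have repr y : exists p, y = (map_poly (GRing.in_alg K) p).[x].
  by apply/Fadjoin1_polyP; rewrite gx memvf.
have [q qE] := choice repr.
have eq0 p : (map_poly (GRing.in_alg K) p).[x] = 0 -> (map_poly ratr p).[r] = 0.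
  move=> px0; have : minPoly 1 x %| map_poly (GRing.in_alg K) p.
    by apply: (@minPoly_dvdp _ _ 1%AS); [apply/polyOver1P; exists p | apply/rootP].
  rewrite fE dvdp_map => /dvdpP[h ->].
  by rewrite rmorphM hornerM (rootP fr) mulr0.
have eqq p p' : (map_poly (GRing.in_alg K) p).[x] = (map_poly (GRing.in_alg K) p').[x] ->
    (map_poly ratr p).[r] = (map_poly ratr p').[r].
  move=> e; apply/eqP; rewrite -subr_eq0 -hornerN -hornerD -rmorphB /=.
  by apply/eqP/eq0; rewrite rmorphB hornerD hornerN e subrr.
pose s0 y := (map_poly (ratr : rat -> F) (q y)).[r].
have sB : GRing.zmod_morphism s0.
  move=> y z; rewrite /s0 -hornerN -hornerD -rmorphB; apply: eqq.
  by rewrite -qE rmorphB hornerD hornerN -!qE.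
have sM : GRing.monoid_morphism s0.
  split=> [|y z].
    rewrite /s0 -[RHS](hornerC 1 r) -[1%:P](rmorph1 (map_poly (ratr : rat -> F))).
    by apply: eqq; rewrite -qE rmorph1 hornerC.
  by rewrite /s0 -hornerM -rmorphM; apply: eqq; rewrite -qE rmorphM hornerM -!qE.
pose s : {rmorphism K -> F} := HB.pack s0
  (GRing.isZmodMorphism.Build K F s0 sB) (GRing.isMonoidMorphism.Build K F s0 sM).
exists s; rewrite -[RHS](hornerX r) -(map_polyX (ratr : rat -> F)).
by apply: eqq; rewrite -qE map_polyX hornerX.
Qed.

(** In characteristic zero [K] has a primitive element, and an integer multiple of it is integral.
    Embeddings correspond to the roots of its minimal polynomial, which are distinct by
    separability. *)
Lemma number_field_embeddings :
  exists d (x : K) (s : 'I_d -> {rmorphism K -> F}),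
  [/\ x \in integral_elements K, injective (fun j => s j x),
      forall y, exists c : 'I_d -> rat, y = \sum_i c i *: x ^+ i
    & forall t : {rmorphism K -> F}, exists j, (t : K -> F) = s j].
Proof.
have sepK : separable 1%AS {:K}%AS.
  by apply/separableP => u _; apply: pcharf0_separable; exact: fieldExt_pchar0.
have [z gz] : exists z : K, <<1; z>>%VS = fullv.
  by exists (separable_generator 1 {:K}); rewrite -eq_adjoin_separable_generator ?sub1v.
have [m m0 mz] := integral_multiple z.
set x := m%:~R * z in mz.
have gx : <<1; x>>%VS = fullv.
  apply/eqP; rewrite eqEsubv subvf -gz /=; apply/FadjoinP; split; first exact: sub1v.
  have -> : z = m%:~R^-1 * x by rewrite mulKf // intr_fieldExt_eq0.
  by rewrite rpredM ?memv_adjoin // rpredV rpred_int.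
have /polyOver1P[f fE] : minPoly 1 x \is a polyOver 1%VS := minPolyOver 1%AS x.
have fm : f \is monic by rewrite -(map_monic (GRing.in_alg K)) -fE monic_minPoly.
have fsep : separable_poly (map_poly (ratr : rat -> F) f).
  rewrite separable_map -(separable_map (GRing.in_alg K)) -fE.
  by rewrite -/(separable_element 1 x); apply: pcharf0_separable; exact: fieldExt_pchar0.
have [r rE] := closed_field_poly_normal (map_poly (ratr : rat -> F) f).
have lc : lead_coef (map_poly (ratr : rat -> F) f) = 1.
  by apply/eqP; rewrite -monicE map_monic.
rewrite lc scale1r in rE.
have ur : uniq r by rewrite -separable_prod_XsubC -rE.
have sr : size f = (size r).+1.
  by rewrite -(size_map_poly (ratr : rat -> F)) rE size_prod_XsubC.
have emb (j : 'I_(size r)) : exists s : {rmorphism K -> F}, s x = r`_j.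
  apply: (embedding_of_root gx fE).
  by rewrite rE root_prod_XsubC mem_nth.
have [s sE] := choice emb; exists (size r), x, s; split=> //.
- move=> i j; rewrite !sE => /eqP; rewrite nth_uniq // => /eqP; exact: val_inj.
- move=> y; have : y \in <<1; x>>%VS by rewrite gx memvf.
  case/Fadjoin1_polyP=> p ->.
  exists (fun i => (p %% f)`_i).
  have szm : (size (p %% f)%R <= size r)%N.
    by rewrite -ltnS -sr ltn_modp monic_neq0.
  rewrite {1}(divp_eq p f) rmorphD rmorphM hornerD hornerM /= -fE minPolyxx mulr0 add0r.
  rewrite (horner_coef_wide _ (n := size r)) ?size_map_poly //.
  by apply: eq_bigr => i _; rewrite coef_map /= mulr_algl.
- move=> t; have : root (map_poly ratr f) (t x).
    by rewrite /root -rmorph_horner_alg -fE minPolyxx rmorph0.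
  rewrite rE root_prod_XsubC => /(nthP 0)[j jr jE]; exists (Ordinal jr).
  apply/funext => y; have : y \in <<1; x>>%VS by rewrite gx memvf.
  by case/Fadjoin1_polyP=> p ->; rewrite !rmorph_horner_alg sE /= jE.
Qed.

End Embeddings.

(** * The lattice spanned by the powers of an integral generator *)

Lemma det_integral (F : comNzRingType) n (A : 'M[F]_n) :
  (forall i j, A i j \in integral_elements F) -> \det A \in integral_elements F.
Proof.
move=> AO; apply: rpred_sum => s _; apply: rpredM; last by apply: rpred_prod.
by rewrite rpredX // rpredN rpred1.
Qed.

Lemma adj_integral (F : comNzRingType) n (A : 'M[F]_n) :
  (forall i j, A i j \in integral_elements F) ->
  forall i j, (\adj A) i j \in integral_elements F.
Proof.
move=> AO i j; rewrite mxE /cofactor; apply: rpredM.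
  by rewrite rpredX // rpredN rpred1.
by apply: det_integral => k l; rewrite !mxE.
Qed.

Section Lattice.
Variables (F : numClosedFieldType) (K : fieldExtType rat).
Local Notation OK := (ring_of_integers K).

Lemma val_integral (y : OK) : val y \in integral_elements K.
Proof. by case: y. Qed.

(** Cramer's rule expresses the coordinates of [y] in the power basis through its conjugates, so [D]
    clears their denominators. The same formula carries nilpotence modulo [p] from [y] to the
    coordinates of [D * y]. *)
Lemma power_basis_lattice :
  exists d (x : OK) (s : 'I_d -> {rmorphism K -> F}) (D : int),
  [/\ injective (fun j => s j (val x)),
      forall t : {rmorphism K -> F}, exists j, (t : K -> F) = s j,
      D != 0
    & forall y : OK, exists z : 'rV[int]_d,
        D%:~R * y = \sum_i (z 0 i)%:~R * x ^+ i
        /\ forall p, prime p -> nilpotent_mod (p%:R : K) (val y) ->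
             forall i, (p %| `|z 0%R i|)%N].
Proof.
have [d [x0 [s [x0O sI bas emb]]]] := number_field_embeddings F K.
pose x : OK := RingOfIntegers x0O.
pose V := Vandermonde d (\row_j s j x0).
have VO i j : V i j \in integral_elements F.
  by rewrite !mxE rpredX // integral_morph.
have detV : \det V != 0.
  rewrite det_Vandermonde; apply/prodf_neq0 => i _; apply/prodf_neq0 => j ij.
  rewrite !mxE subr_eq0; apply: contraTneq ij => /sI ->; by rewrite ltnn.
(* The determinant itself need not be rational; [D] is a nonzero rational integer that it
   divides. *)
have [D D0 [u uO uD]] := integral_dvd_int (det_integral VO) detV.
exists d, x, s, D; split=> // y.
have [c cE] := bas (val y).
(* Cramer's rule for [(s_j y)_j = c *m V]. *)
have cV i : ratr (D%:~R * c i) = \sum_j s j (val y) * (u * (\adj V) j i).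
  rewrite rmorphM rmorph_int -uD.
  have e : (\row_j s j (val y)) = (\row_i ratr (c i)) *m V.
    apply/rowP => j; rewrite !mxE cE rmorph_sum; apply: eq_bigr => k _.
    by rewrite !mxE -mulr_algl rmorphM rmorphXn alg_num_field fmorph_rat.
  have := congr1 (fun A => (A *m \adj V) 0 i) e.
  rewrite -mulmxA mul_mx_adj mul_mx_scalar !mxE => e'.
  rewrite [_ * u]mulrC -mulrA -e' mulr_sumr.
  by apply: eq_bigr => j _; rewrite !mxE mulrCA.
have cO j i : u * (\adj V) j i \in integral_elements F.
  by rewrite rpredM //; apply: adj_integral.
have zE i : exists z : int, D%:~R * c i = z%:~R.
  apply: (@integral_rat_int F); rewrite cV; apply: rpred_sum => j _.
  by rewrite rpredM // integral_morph // val_integral.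
have [z {}zE] := choice zE; exists (\row_i z i); split=> [|p pp ynil i].
  apply: val_inj; rewrite rmorphM rmorph_int rmorph_sum.
  under [RHS]eq_bigr => i _ do rewrite mxE rmorphM rmorph_int rmorphXn.
  rewrite /= cE mulr_sumr; apply: eq_bigr => i _.
  rewrite -[c i *: _]mulr_algl mulrA; congr (_ * _).
  rewrite -[D%:~R](rmorph_int (GRing.in_alg K)) -rmorphM zE /=.
  by rewrite -[LHS]/(GRing.in_alg K _) rmorph_int.
rewrite mxE; apply: (@nilpotent_mod_prime F) => //.
have -> : (z i)%:~R = \sum_j s j (val y) * (u * (\adj V) j i).
  by rewrite -cV zE [RHS]rmorph_int.
elim/big_ind: _ => [|a b|j _]; [exact: nilpotent_mod0|exact: nilpotent_modD|].
apply: nilpotent_modM => //; case: ynil => yO [k [t tO e]].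
split; first exact: integral_morph.
by exists k, (s j t); rewrite ?integral_morph // -rmorphXn e rmorphM rmorph_nat.
Qed.

End Lattice.

(** * Index of principal ideals *)

Lemma absz_unit (z : int) : z \is a GRing.unit -> `|z|%N = 1%N.
Proof. by rewrite [z \in _]/(_ || _) => /orP[] /eqP ->. Qed.

(** The Smith normal form turns the row lattice of [W] into a product of multiples of the integers;
    reducing coordinates modulo the invariant factors leaves at most [|det W|] classes. *)
Lemma card_incongruent_det n (W : 'M[int]_n) (I : finType) (g : I -> 'rV[int]_n) :
  \det W != 0 ->
  (forall i j, i != j -> forall k : 'rV[int]_n, g i - g j <> k *m W) ->
  (#|I| <= `|\det W|)%N.
Proof.
move=> W0 gW; have [L uL [U uU [d _ WE]]] := int_Smith_normal_form W.
pose e (j : nat) := d`_j.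
pose c := \row_(j < n) e j.
have WE' : W = L *m diag_mx c *m U.
  rewrite WE; congr (_ *m _ *m _); apply/matrixP => i j; rewrite !mxE.
  by rewrite -val_eqE.
have detW : `|\det W|%N = (\prod_(j < n) `|e j|)%N.
  rewrite WE' !det_mulmx !abszM det_diag.
  rewrite (@absz_unit (\det L)) -?unitmxE // (@absz_unit (\det U)) -?unitmxE //.
  rewrite mul1n muln1.
  rewrite (big_morph absz abszM absz1); apply: eq_bigr => j _; by rewrite mxE.
have d0 j : (j < n)%N -> e j != 0.
  move=> jn; apply: contraNneq W0 => dj; rewrite -absz_eq0 detW.
  by rewrite (bigD1 (Ordinal jn)) //= dj.
pose v i := g i *m invmx U.
have ltd i (j : 'I_n) : (`|((v i) 0%R j %% e j)%Z| < `|e j|)%N.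
  have := ltz_mod ((v i) 0 j) (d0 j (ltn_ord j)).
  by have := modz_ge0 ((v i) 0 j) (d0 j (ltn_ord j)); lia.
pose f i : {dffun forall j : 'I_n, 'I_(`|e j|)} := [ffun j => Ordinal (ltd i j)].
have finj : injective f.
  move=> i j fij; apply/eqP/negPn/negP => /gW.
  (* When all residues agree, the differences of quotients give the combination of rows, once [L] is
     undone. *)
  pose k := \row_(l < n) ((v i 0%R l %/ e l)%Z - (v j 0%R l %/ e l)%Z).
  move/(_ (k *m invmx L)); apply.
  rewrite WE' !mulmxA mulmxKV // -[LHS](mulmxKV uU); congr (_ *m _).
  rewrite mulmxBl -/(v i) -/(v j); apply/rowP => l.
  rewrite mul_mx_diag [LHS]mxE [X in _ + X]mxE [RHS]mxE [k _ _]mxE [c _ _]mxE.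
  have := congr1 (fun h : {dffun forall j : 'I_n, 'I_(`|e j|)} => nat_of_ord (h l)) fij.
  rewrite !ffunE /= => fe.
  rewrite {1}(divz_eq (v i 0 l) (e l)) {1}(divz_eq (v j 0 l) (e l)).
  have -> : (v i 0%R l %% e l = v j 0%R l %% e l)%Z.
    move: fe; have := modz_ge0 (v i 0 l) (d0 l (ltn_ord l)).
    by have := modz_ge0 (v j 0 l) (d0 l (ltn_ord l)); lia.
  by ring.
rewrite (leq_trans (leq_card f finj)) // card_dep_ffun detW.
rewrite foldrE big_image /=.
by apply/eq_leq/eq_bigr => j _; rewrite card_ord.
Qed.

Section Index.
Variables (F : numClosedFieldType) (K : fieldExtType rat).
Local Notation OK := (ring_of_integers K).

Lemma intr_integer_eq0 (z : int) : (z%:~R == 0 :> OK) = (z == 0).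
Proof.
by rewrite -(intr_fieldExt_eq0 K) -(inj_eq val_inj) rmorph_int raddf0.
Qed.

(** Up to [D], multiplication by [a] acts on the power basis by an integer matrix [W] with
    eigenvalues [D * s_j a]. Elements incongruent modulo [a] have coordinates incongruent modulo the
    rows of [W], so there are at most [|det W|] of them. *)
Lemma index_bound :
  exists d (s : 'I_d -> {rmorphism K -> F}) (C : nat),
  [/\ injective (fun j => s j : K -> F),
      forall t : {rmorphism K -> F}, exists j, (t : K -> F) = s j
    & forall (a : OK) (I : finType) (g : I -> OK), a != 0 ->
        (forall i j, i != j -> forall b : OK, g i - g j <> a * b) ->
        #|I|%:R <= C%:R * \prod_j `|s j (val a)| :> F].
Proof.
have [d [x [s [D [sI emb D0 rep]]]]] := power_basis_lattice F K.
exists d, s, (`|D| ^ d)%N; split=> //.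
  by move=> i j /= e; apply: sI; rewrite /= e.
move=> a I g a0 ga.
pose t j : {rmorphism OK -> F} := s j \o val.
have [c cE] := choice (fun y => rep y).
pose W := \matrix_(i < d, j < d) c (a * x ^+ i) 0 j.
pose V : 'M[F]_d := Vandermonde d (\row_j t j x).
(* The columns of the Vandermonde matrix are eigenvectors of [W], because each embedding is
   multiplicative. *)
have WV : map_mx intr W *m V = V *m diag_mx (\row_j (D%:~R * t j a)).
  apply/matrixP => i j; rewrite mul_mx_diag !mxE.
  have := congr1 (t j) (cE (a * x ^+ i)).1.
  rewrite !rmorphM rmorph_sum rmorph_int rmorphXn => e.
  rewrite mulrC -mulrA e; apply: eq_bigr => l _.
  by rewrite !mxE rmorphM rmorph_int rmorphXn.
have detV : \det V != 0.
  rewrite det_Vandermonde; apply/prodf_neq0 => i _; apply/prodf_neq0 => j ij.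
  rewrite !mxE subr_eq0; apply: contraTneq ij => /sI ->; by rewrite ltnn.
have detW : (\det W)%:~R = \prod_j (D%:~R * t j a).
  have := congr1 determinant WV; rewrite !det_mulmx det_diag mulrC => /(mulfI detV).
  rewrite det_map_mx => ->; by apply: eq_bigr => j _; rewrite mxE.
have W0 : \det W != 0.
  rewrite -(intr_eq0 F) detW; apply/prodf_neq0 => j _.
  rewrite mulf_neq0 ?intr_eq0 // /t /= fmorph_eq0.
  by apply: contra a0 => /eqP e; apply/eqP/val_inj.
have : (#|I| <= `|\det W|)%N.
  apply: (card_incongruent_det (g := fun i => c (g i)) W0) => i j ij k e.
  (* A congruence [k] modulo the rows of [W] would make [g i - g j] the product of [a] and this
     element, after cancelling [D]. *)
  apply: (ga i j ij (\sum_l (k 0 l)%:~R * x ^+ l)).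
  have D0' : (D%:~R : OK) != 0 by rewrite intr_integer_eq0.
  apply: (mulfI D0').
  rewrite mulrBr (cE (g i)).1 (cE (g j)).1.
  rewrite -sumrB; under eq_bigr => l _ do rewrite -mulrBl -rmorphB.
  have {}e l : c (g i) 0 l - c (g j) 0 l = \sum_(m < d) k 0 m * c (a * x ^+ m) 0 l.
    have := congr1 (fun A : 'rV[int]_d => A 0 l) e; rewrite !mxE => ->.
    by apply: eq_bigr => m _; rewrite mxE.
  under eq_bigr => l _ do rewrite e rmorph_sum mulr_suml.
  rewrite exchange_big /= !mulr_sumr; apply: eq_bigr => m _.
  rewrite [RHS](_ : _ = (k 0 m)%:~R * (D%:~R * (a * x ^+ m))); last by ring.
  rewrite (cE (a * x ^+ m)).1 mulr_sumr.
  by apply: eq_bigr => l _; rewrite !rmorphM /= mulrA.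
rewrite -(ler_nat F) => /le_trans; apply.
rewrite natr_absz intr_norm detW normr_prod.
under eq_bigr => j _ do rewrite normrM -intr_norm -natr_absz.
by rewrite big_split /= prodr_const card_ord natrX.
Qed.

End Index.

(** If [y] is nilpotent modulo [p], then [p] divides all the coordinates of [D * y]. Hence [O / p O]
    is reduced when [p] is prime to [D]. *)
Lemma reduced_mod_prime (K : fieldExtType rat) :
  exists2 D : int, D != 0 &
    forall p (y t : ring_of_integers K) k, prime p -> y ^+ k = p%:R * t ->
      exists t', D%:~R * y = p%:R * t'.
Proof.
have [d [x [s [D [_ _ D0 rep]]]]] := power_basis_lattice algC K.
exists D => // p y t k pp ykt; have [z [-> /(_ p pp) zp]] := rep y.
have ynil : nilpotent_mod (p%:R : K) (val y).
  split; first exact: val_integral.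
  exists k, (val t); first exact: val_integral.
  by have := congr1 val ykt; rewrite rmorphXn rmorphM rmorph_nat.
have {}zp i : exists w : int, z 0 i = p%:Z * w.
  have /dvdzP[w ->] : (p%:Z %| z 0%R i)%Z by exact: zp.
  by exists w; rewrite mulrC.
have [w wE] := choice zp; exists (\sum_i (w i)%:~R * x ^+ i).
by rewrite mulr_sumr; apply: eq_bigr => i _; rewrite wE rmorphM /= mulrA.
Qed.

Lemma card_incongruent_bounded (K : fieldExtType rat) (a : ring_of_integers K) :
  a != 0 -> exists B, forall (I : finType) (g : I -> ring_of_integers K),
    (forall i j, i != j -> forall b : ring_of_integers K, g i - g j <> a * b) ->
    (#|I| <= B)%N.
Proof.
move=> a0; have [d [s [C [_ _ bd]]]] := index_bound algC K.
exists (Num.bound (C%:R * \prod_j `|s j (val a)|)) => I g /(bd a I g a0) le.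
rewrite -(ler_nat algC) (le_trans le) // ltW // archi_boundP //.
by rewrite mulr_ge0 ?ler0n // prodr_ge0.
Qed.

(** * Ideals *)

(** Unlike [idealr_closed], this admits the unit ideal, which occurs as [ideal_exp I 0]. *)
Definition is_ideal (A : comNzRingType) (I : set A) : Prop :=
  [/\ I 0, forall x y, I x -> I y -> I (x - y) & forall a x, I x -> I (a * x)].

Section IdealArithmetic.
Variable A : comNzRingType.
Implicit Types (I J P : set A) (x y a : A).

Lemma idealN I x : is_ideal I -> I x -> I (- x).
Proof. by move=> [I0 IB _] Ix; rewrite -sub0r; exact: IB. Qed.

Lemma idealD I x y : is_ideal I -> I x -> I y -> I (x + y).
Proof.
move=> II Ix Iy; rewrite -[y]opprK; case: (II) => _ IB _.
by apply: IB => //; exact: idealN.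
Qed.

Lemma ideal_mulr I x a : is_ideal I -> I x -> I (x * a).
Proof. by move=> [_ _ IM] Ix; rewrite mulrC; exact: IM. Qed.

Lemma idealDr I x y : is_ideal I -> I y -> I (x + y) -> I x.
Proof. by move=> [_ IB _] Iy Ixy; rewrite -[x](addrK y); exact: IB. Qed.

Lemma ideal_trans I x y z : is_ideal I -> I (x - y) -> I (y - z) -> I (x - z).
Proof. by move=> II Ixy Iyz; rewrite -(subrKA y); exact: idealD. Qed.

Lemma ideal_sum I (T : Type) (r : seq T) (Q : pred T) (f : T -> A) :
  is_ideal I -> (forall i, Q i -> I (f i)) -> I (\sum_(i <- r | Q i) f i).
Proof.
move=> II If; elim/big_ind: _ => //; last by move=> x y; exact: idealD.
by case: II.
Qed.

Lemma ideal_congM I x x' y y' : is_ideal I ->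
  I (x - x') -> I (y - y') -> I (x * y - x' * y').
Proof.
move=> II Ix Iy; have -> : x * y - x' * y' = (x - x') * y + x' * (y - y') by ring.
by apply: idealD => //; [exact: ideal_mulr | case: II => _ _; apply].
Qed.

Lemma is_ideal_mul I J : is_ideal I -> is_ideal J -> is_ideal (ideal_mul I J).
Proof.
move=> II IJ; split.
- by exists [::]; rewrite ?big_nil.
- move=> x y [s sI ->] [t tI ->].
  exists (s ++ [seq (- u.1, u.2) | u <- t]) => [u|].
    rewrite mem_cat => /orP[/sI//|/mapP[v /tI[v1 v2] ->]] /=.
    by split=> //; exact: idealN.
  rewrite big_cat big_map /= -sumrN; congr (_ + _); apply: eq_bigr => u _ /=.
  by rewrite mulNr.
- move=> a x [s sI ->]; exists [seq (a * u.1, u.2) | u <- s] => [u|].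
    by move=> /mapP[v /sI[v1 v2] ->]; split=> //=; case: II => _ _; apply.
  by rewrite big_map mulr_sumr; apply: eq_bigr => u _; rewrite mulrA.
Qed.

Lemma is_ideal_exp I n : is_ideal I -> is_ideal (ideal_exp I n).
Proof. by move=> II; elim: n => [|n IHn]; [split|apply: is_ideal_mul]. Qed.

Lemma ideal_exp1 I : is_ideal I -> ideal_exp I 1 = I.
Proof.
move=> II; apply/seteqP; split=> x /=.
  case=> s sI ->; rewrite big_seq; apply: ideal_sum => // u /sI[u1 _].
  exact: ideal_mulr.
move=> Ix; exists [:: (x, 1)] => [u|]; last by rewrite big_seq1 mulr1.
by rewrite inE => /eqP ->.
Qed.

Lemma ideal_exp2M I x y : is_ideal I -> I x -> I y -> ideal_exp I 2 (x * y).
Proof.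
move=> II Ix Iy; exists [:: (x, y)] => [u|]; last by rewrite big_seq1.
by rewrite inE => /eqP ->; split=> //; rewrite -/(ideal_exp I 1) ideal_exp1.
Qed.

Lemma ideal_exp_subS I n : is_ideal I -> ideal_exp I n.+1 `<=` ideal_exp I n.
Proof.
move=> II x [s sI ->]; rewrite big_seq; apply: ideal_sum => [|u /sI[_ u2]].
  exact: is_ideal_exp.
by case: (is_ideal_exp n II) => _ _; apply.
Qed.

Lemma ideal_exp_sub I m n : is_ideal I -> (m <= n)%N ->
  ideal_exp I n `<=` ideal_exp I m.
Proof.
move=> II /subnK <-; elim: (n - m)%N => // k IHk x /ideal_exp_subS /IHk; exact.
Qed.

Lemma prime_idealP P : nonzero_prime_ideal P ->
  [/\ is_ideal P, ~ P 1, forall x y, P (x * y) -> P x \/ P y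
    & exists2 x, x != 0 & P x].
Proof.
have mE x : (x \in [in P]) = P x :> Prop.
  by rewrite -[x \in _]/(x \in P) in_setE.
case=> [[P0 P1 PM] Pp Pn]; rewrite mE in P0.
have {}PM a x y : P x -> P y -> P (a * x + y).
  by move=> Px Py; rewrite -mE; apply: PM; rewrite mE.
have PI : is_ideal P.
  split=> // [x y Px Py|a x Px]; last by rewrite -[_ * _]addr0; exact: PM.
  by rewrite addrC -mulN1r; exact: PM.
split=> //.
- by rewrite -mE; exact/negP.
- move=> x y Pxy; have /orP : (x \in [in P]) || (y \in [in P]).
    by apply: Pp; rewrite mE.
  by rewrite !mE.
- apply: contrapT => h; apply: Pn; apply/seteqP; split=> x /=.
    by move=> Px; apply: contrapT => x0; apply: h; exists x => //; apply/eqP.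
  by move=> ->; case: PI.
Qed.

(** * Finite quotient rings handled through representatives *)

Section Representatives.
Variables (I : set A) (N : nat) (r : 'I_N -> A).
Hypotheses (II : is_ideal I) (rI : forall i j, I (r i - r j) -> i = j).
Hypothesis rS : forall x, exists i, I (x - r i).

(** The function [f] plays the part of the projection onto the quotient, identified with ['I_N]. *)
Lemma reps_index : exists f : A -> 'I_N,
  (forall x, I (x - r (f x))) /\ (forall x y, f x = f y <-> I (x - y)).
Proof.
have [f fP] := choice rS; exists f; split=> // x y; split=> [e|Ixy].
  apply: ideal_trans (fP x) _ => //; rewrite e -opprB; exact: idealN.
apply: rI; apply: (ideal_trans (y := x)) => //.
  by rewrite -opprB; exact: idealN.
exact: ideal_trans Ixy (fP y).
Qed.

(** Translation by 1 permutes the classes; comparing the sums of representatives before and after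
    leaves [N] times 1. *)
Lemma card_reps_in_ideal : I N%:R.
Proof.
have [f [fP fE]] := reps_index.
pose t i := f (r i + 1).
have tI : injective t.
  by move=> i j /fE; rewrite opprD addrACA subrr addr0; exact: rI.
have : I (\sum_i (r i + 1) - \sum_i r i).
  rewrite [X in _ - X](reindex_inj tI) -sumrB; exact: ideal_sum.
by rewrite big_split /= addrAC subrr add0r sumr_const card_ord.
Qed.

Hypotheses (I1 : ~ I 1) (Ip : forall x y, I (x * y) -> I x \/ I y).

(** Multiplication by [a] is injective on a finite domain, hence surjective. *)
Lemma inverse_mod a : ~ I a -> exists b, I (a * b - 1).
Proof.
move=> Ia; have [f [fP fE]] := reps_index.
pose t i := f (a * r i).
have tI : injective t.
  by move=> i j /fE; rewrite -mulrBr => /Ip[//|]; exact: rI.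
have [g _ tg] := injF_bij tI.
by exists (r (g (f 1))); apply/fE; exact: tg.
Qed.

(** Multiplication by [a] permutes the [N.-1] nonzero classes, whose product [q] can be cancelled
    because [I] is prime. *)
Lemma fermat_mod a : ~ I a -> I (a ^+ N.-1 - 1).
Proof.
move=> Ia; have [f [fP fE]] := reps_index.
pose t i := f (a * r i).
have tI : injective t.
  by move=> i j /fE; rewrite -mulrBr => /Ip[//|]; exact: rI.
have r0 i : I (r i) <-> i = f 0.
  rewrite -{1}[r i]subr0 -fE; split=> [<-|->]; last first.
    apply/fE; rewrite subr0; have := fP 0.
    by rewrite sub0r => /(idealN II); rewrite opprK.
  by apply: rI; exact: fP.
have t0 i : (t i != f 0) = (i != f 0).
  congr (~~ _); apply/eqP/eqP => [/fE|].
    by rewrite subr0 => /Ip[//|/r0].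
  by move=> /r0 ri; apply/fE; rewrite subr0; case: II => _ _; apply.
pose q := \prod_(i | i != f 0) r i.
have Iq : ~ I q.
  rewrite /q; elim/big_ind: _ => // [x y Ix Iy /Ip[]//|i /eqP i0 /r0//].
have : I ((a ^+ N.-1 - 1) * q).
  have -> : (a ^+ N.-1 - 1) * q =
      \prod_(i | i != f 0) (a * r i) - \prod_(i | i != f 0) r (t i).
    rewrite mulrBl mul1r big_split /= prodr_const; congr (_ * _ - _).
      by rewrite cardC1 card_ord.
    by rewrite /q (reindex_inj tI); apply: eq_bigl => i; rewrite t0.
  elim/big_ind2: _ => [|x x' y y'|i _]; first by rewrite subrr; case: II.
    exact: ideal_congM.
  exact: fP.
by case/Ip.
Qed.

End Representatives.

End IdealArithmetic.

(** * Wieferich and ramified primes *)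

Section NumberField.
Variable K : fieldExtType rat.
Local Notation OK := (ring_of_integers K).
Implicit Types (I P : set OK) (a : OK).

(** Representatives of distinct cosets are incongruent modulo [a], so their number is bounded. This
    makes [ideal_norm I] the true index and not a default value. *)
Lemma finite_ideal_cosets I a :
  is_ideal I -> a != 0 -> I a -> finite_set (ideal_cosets I).
Proof.
move=> II a0 Ia; apply: contrapT => inf.
have [B bd] := card_incongruent_bounded a0.
have [X XI XB] := infinite_set_fset B.+1 inf.
have rep (c : X) : exists x, val c = [set y | y - x \in I].
  by have [x _ <-] : ideal_cosets I (val c); [apply: XI; exact: valP | exists x].
have [g gE] := choice rep.
have : (#|{: X}| <= B)%N.
  apply: (bd _ g) => c c' /eqP cc' b e; apply/cc'/val_inj; rewrite !gE.
  have Ie : I (g c - g c') by rewrite e; exact: (ideal_mulr b II Ia).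
  apply/seteqP; split=> y /=; rewrite !in_setE => Iy.
    exact: ideal_trans Iy Ie.
  by apply: (ideal_trans II) Iy _; rewrite -opprB; exact: idealN.
by rewrite -cardfE leqNgt XB.
Qed.

Lemma ideal_reps I a : is_ideal I -> a != 0 -> I a ->
  exists r : 'I_(ideal_norm I) -> OK,
    (forall i j, I (r i - r j) -> i = j) /\ (forall x, exists i, I (x - r i)).
Proof.
move=> II a0 Ia; have fin := finite_ideal_cosets II a0 Ia.
rewrite /ideal_norm; set X := fset_set _.
have XE c : (c \in X) = (c \in ideal_cosets I) by rewrite in_fset_set.
have rep (i : 'I_(#|` X|)%fset) : exists x, nth set0 X i = [set y | y - x \in I].
  have : nth set0 X i \in X by rewrite mem_nth.
  by rewrite XE in_setE => -[x _ <-]; exists x.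
have [r rE] := choice rep; exists r; split=> [i j Iij|x].
  apply/val_inj/eqP; rewrite -(nth_uniq set0 (ltn_ord i) (ltn_ord j)) ?fset_uniq //.
  rewrite !rE; apply/eqP/seteqP; split=> y /=; rewrite !in_setE => Iy.
    exact: ideal_trans Iy Iij.
  by apply: (ideal_trans II) Iy _; rewrite -opprB; exact: idealN.
pose c := [set y | y - x \in I].
have cX : c \in X by rewrite XE in_setE; exists x.
have iX : (index c X < #|` X|)%N by rewrite index_mem.
exists (Ordinal iX).
have := rE (Ordinal iX); rewrite /= nth_index // /c => /seteqP[+ _] => /(_ x) /=.
by rewrite subrr !in_setE; apply; case: II.
Qed.

Definition principal a : set OK := [set y | exists b, y = a * b].

Lemma is_ideal_principal a : is_ideal (principal a).
Proof.
split.
- by exists 0; rewrite mulr0.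
- by move=> x y [b ->] [c ->]; exists (b - c); rewrite mulrBr.
- by move=> c x [b ->]; exists (c * b); rewrite mulrCA.
Qed.

Lemma principal_self a : principal a a.
Proof. by exists 1; rewrite mulr1. Qed.

(** Such an ideal is determined by which of the finitely many representatives modulo [a] it
    contains. *)
Lemma finite_ideals_containing a : a != 0 -> finite_set [set I | is_ideal I /\ I a].
Proof.
move=> a0.
have [r [_ rS]] := ideal_reps (is_ideal_principal a) a0 (principal_self a).
pose J (T : {set 'I_(ideal_norm (principal a))}) : set OK :=
  [set x | exists2 i, i \in T & principal a (x - r i)].
apply: (@sub_finite_set _ _ [set J T | T in setT]); last exact: finite_image.
move=> I [II Ia]; exists [set i | r i \in I]%SET => //.
have aI : principal a `<=` I by move=> y [b ->]; exact: ideal_mulr.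
apply/seteqP; split=> x /=.
  case=> i; rewrite finset.inE in_setE => Ir /aI Ixr.
  by rewrite -[x](subrK (r i)); exact: idealD.
move=> Ix; have [i Ii] := rS x; exists i => //; rewrite finset.inE in_setE.
rewrite -[r i](subKr x); case: (II) => _ IB _; apply: IB => //; exact: aI.
Qed.

(** By Fermat the failure of the non-Wieferich condition puts [eta ^+ N.-1 - 1] in the square of
    [P]. This is first transferred to the exponent [gcdn n N.-1], then to its multiple [n]. *)
Lemma wieferich_exp2 (P : set OK) (eta : OK) n :
  nonzero_prime_ideal P -> eta \is a GRing.unit -> ~ non_wieferich eta P ->
  (0 < n)%N -> P (eta ^+ n - 1) -> ideal_exp P 2 (eta ^+ n - 1).
Proof.
move=> Pp eU nW n0 Pn; have [PI P1 Pm [a a0 Pa]] := prime_idealP Pp.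
have [r [rI rS]] := ideal_reps PI a0 Pa.
set N := ideal_norm P in r rI rS.
have PN : P N%:R := card_reps_in_ideal PI rI rS.
have N0 : (0 < N)%N by have [[i iN] _] := rS 0; exact: leq_ltn_trans iN.
have P2I := is_ideal_exp 2 PI.
have Pe : ~ P eta.
  by move=> /(@ideal_mulr _ _ _ eta^-1 PI); rewrite divrr.
have PF : P (eta ^+ N.-1 - 1) := fermat_mod PI rI rS P1 Pm Pe.
have P2F : ideal_exp P 2 (eta ^+ N.-1 - 1).
  by apply: contrapT => nP2; apply: nW; split; rewrite ?in_setE // notin_setE.
have powI J x k : is_ideal J -> J (x - 1) -> J (x ^+ k - 1).
  by move=> JI Jx; rewrite subrX1; exact: ideal_mulr.
pose g := gcdn n N.-1; pose x := eta ^+ g.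
(* Bezout: [eta] has order dividing both [n] and [N.-1] modulo [P]. *)
have Px : P (x - 1).
  rewrite /x /g; case: (egcdnP N.-1 n0) => u v e _.
  have Pu : P (eta ^+ (u * n) - 1) by rewrite mulnC exprM; exact: powI.
  have Pv : P (eta ^+ (v * N.-1) - 1) by rewrite mulnC exprM; exact: powI.
  move: Pu; rewrite e exprD => Pu.
  set y := eta ^+ gcdn _ _ in Pu *; set z := eta ^+ (_ * _) in Pu Pv.
  have -> : y - 1 = (z * y - 1) - y * (z - 1) by ring.
  by case: (PI) => _ PB PM; apply: PB => //; exact: PM.
have [k kE] : exists k, N.-1 = (g * k)%N.
  by have /dvdnP[k ->] : (g %| N.-1)%N; [exact: dvdn_gcdr | exists k; rewrite mulnC].
have [l lE] : exists l, n = (g * l)%N.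
  by have /dvdnP[l ->] : (g %| n)%N; [exact: dvdn_gcdl | exists l; rewrite mulnC].
pose s := \sum_(i < k) x ^+ i.
have xs : ideal_exp P 2 ((x - 1) * s) by rewrite -subrX1 -exprM -kE.
(* Modulo [P] the sum [s] is [k], and [g * k = N.-1] is congruent to -1, so [k] is invertible. *)
have Ps : ~ P s.
  move=> Ps; have Pk : P k%:R.
    have -> : k%:R = s - \sum_(i < k) (x ^+ i - 1).
      by rewrite sumrB sumr_const card_ord subKr.
    case: (PI) => _ PB _; apply: PB => //; apply: ideal_sum => // i _; exact: powI.
  apply: P1; have -> : 1 = N%:R - (g * k)%:R :> OK.
    by rewrite -kE -natrB ?leq_pred // -{1}(prednK N0) subSnn.
  by case: (PI) => _ PB PM; apply: PB => //; rewrite natrM; exact: PM.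
have [b Pb] := inverse_mod PI rI rS Pm Ps.
have P2x : ideal_exp P 2 (x - 1).
  have -> : x - 1 = (x - 1) * s * b - (x - 1) * (s * b - 1) by ring.
  case: (P2I) => _ PB _; apply: PB; first exact: ideal_mulr.
  exact: ideal_exp2M.
by rewrite lE exprM; exact: powI.
Qed.

(* [O / p] is reduced when [D] is prime to [p]; as it is also finite, each of its
   elements [a] satisfies [a ^+ l.+1 = a] for some [l > 0], so that the
   idempotent [1 - a ^+ l] kills [a]. *)
Lemma ramified_divides : exists2 D : int, D != 0 &
  forall P p, nonzero_prime_ideal P -> prime p -> P p%:R ->
    ideal_exp P 2 p%:R -> P D%:~R.
Proof.
have [D D0 red] := reduced_mod_prime K.
exists D => // P p Pp pp Pp1 Pp2; have [PI P1 Pm _] := prime_idealP Pp.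
apply: contrapT => PD.
have p0 : (p%:R : OK) != 0.
  by rewrite -[p%:R]/(p%:~R) intr_integer_eq0 -lt0n prime_gt0.
(* Every element of [P] is annihilated modulo [p] by some element outside [P]. *)
have kill a : P a -> exists2 f, ~ P f & principal p%:R (f * a).
  move=> Pa.
  have [r [rI rS]] := ideal_reps (is_ideal_principal p%:R) p0 (principal_self _).
  have [h [_ hE]] := reps_index (is_ideal_principal p%:R) rI rS.
  set N := ideal_norm _ in h hE.
  (* Pigeonhole: two of the first [N.+1] powers of [a] agree modulo [p]. *)
  have [i [j [ij hij]]] : exists i j, (i < j)%N /\ h (a ^+ i) = h (a ^+ j).
    apply: contrapT => nij.
    have : injective (fun i : 'I_N.+1 => h (a ^+ i)).
      move=> i j e; apply/val_inj; case: (ltngtP i j) => // lt; case: nij.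
        by exists i, j.
      by exists j, i.
    by move/leq_card; rewrite !card_ord ltnn.
  have [t tE] := (hE _ _).1 hij.
  pose l := (j - i)%N.
  (* The element [a * (1 - a ^+ l)] is nilpotent: its power [i.+1] contains the factor
     [a ^+ i - a ^+ j]. *)
  have [t' t'E] : exists t', D%:~R * (a * (1 - a ^+ l)) = p%:R * t'.
    apply: (red p _ (a * t * (1 - a ^+ l) ^+ i) i.+1) => //.
    have -> : p%:R * (a * t * (1 - a ^+ l) ^+ i) =
      a * (p%:R * t) * (1 - a ^+ l) ^+ i by ring.
    by rewrite -tE -(subnKC (ltnW ij)) exprD -/l exprMn !exprS; ring.
  exists (D%:~R * (1 - a ^+ l)); last by exists t'; rewrite -t'E; ring.
  case/Pm => // Pl; apply: P1; rewrite -[1](subrK (a ^+ l)); apply: idealD => //.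
  by rewrite -(@prednK l) ?subn_gt0 // exprS; exact: ideal_mulr.
case: Pp2 => s sP pE; have {}sP u : u \in s -> P u.1 /\ P u.2.
  by move=> /sP[u1 u2]; split=> //; rewrite -(ideal_exp1 PI).
have [f Pf fs] : exists2 f, ~ P f &
    forall u, u \in s -> principal p%:R (f * u.1) /\ principal p%:R (f * u.2).
  elim: s sP {pE} => [|u s IHs] sP; first by exists 1.
  have [|f Pf fs] := IHs; first by move=> v vs; apply: sP; rewrite inE vs orbT.
  have [Pu1 Pu2] := sP u (mem_head _ _).
  have [f1 Pf1 fu1] := kill _ Pu1; have [f2 Pf2 fu2] := kill _ Pu2.
  exists (f * f1 * f2) => [/Pm[/Pm[]|]//|v]; rewrite inE => /predU1P[->|/fs[v1 v2]].
    have -> : f * f1 * f2 * u.1 = (f * f2) * (f1 * u.1) by ring.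
    have -> : f * f1 * f2 * u.2 = (f * f1) * (f2 * u.2) by ring.
    have [_ _ M] := is_ideal_principal (p%:R : OK).
    by split; [exact: (M _ _ fu1) | exact: (M _ _ fu2)].
  have -> : f * f1 * f2 * v.1 = (f1 * f2) * (f * v.1) by ring.
  have -> : f * f1 * f2 * v.2 = (f1 * f2) * (f * v.2) by ring.
  have [_ _ M] := is_ideal_principal (p%:R : OK).
  by split; [exact: (M _ _ v1) | exact: (M _ _ v2)].
(* Each product in the expression of [p] as an element of the square of [P] gains a factor [p] twice
   from [f * f]. Cancelling one [p] puts [f * f] in [P], although [f] lies outside. *)
have [t tE] : principal (p%:R * p%:R) (f * f * p%:R).
  rewrite {3}pE mulr_sumr big_seq.
  apply: (ideal_sum _ (is_ideal_principal (p%:R * p%:R))) => u.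
  move=> /fs[[t1 e1] [t2 e2]]; exists (t1 * t2).
  have -> : f * f * (u.1 * u.2) = (f * u.1) * (f * u.2) by ring.
  by rewrite e1 e2; ring.
have : P (f * f).
  have -> : f * f = p%:R * t by apply: (mulIf p0); rewrite tE; ring.
  exact: ideal_mulr.
by case/Pm.
Qed.

End NumberField.

(** * Products of norms of primes *)

Section Counting.
Variable K : fieldExtType rat.
Local Notation OK := (ring_of_integers K).
Implicit Types (P Q : set OK) (a x y z t : OK).

Lemma prime_reps P : nonzero_prime_ideal P ->
  exists r : 'I_(ideal_norm P) -> OK,
    (forall i j, P (r i - r j) -> i = j) /\ (forall x, exists i, P (x - r i)).
Proof. by case/prime_idealP=> PI _ _ [a a0 Pa]; exact: ideal_reps PI a0 Pa. Qed.

Lemma prime_inverse P a : nonzero_prime_ideal P -> ~ P a ->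
  exists b, P (a * b - 1).
Proof.
move=> Pp Pa; have [r [rI rS]] := prime_reps Pp.
have [PI _ Pm _] := prime_idealP Pp.
by have [b Pb] := inverse_mod PI rI rS Pm Pa; exists b.
Qed.

(** An inverse [b] of [y] modulo [P] gives one modulo the square of [P], by expanding
    [(y * b - 1) ^+ 2]. *)
Lemma prime_exp2_cancel P y x : nonzero_prime_ideal P -> ~ P y ->
  ideal_exp P 2 (y * x) -> ideal_exp P 2 x.
Proof.
move=> Pp Py Pyx; have [PI _ _ _] := prime_idealP Pp.
have [b Pb] := prime_inverse Pp Py; have P2I := is_ideal_exp 2 PI.
have -> : x = (y * b - 1) * (y * b - 1) * x - y * x * (b * (y * b - 1 - 1)) by ring.
case: (P2I) => _ PB _; apply: PB; last exact: ideal_mulr.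
by apply: ideal_mulr => //; exact: ideal_exp2M.
Qed.

(** Nonzero primes are maximal: an element of [P] outside [Q] is invertible modulo [Q], so an
    inclusion of [Q] in [P] would put 1 in [P]. *)
Lemma prime_incomparable P Q : nonzero_prime_ideal P -> nonzero_prime_ideal Q ->
  P <> Q -> exists2 z, Q z & ~ P z.
Proof.
move=> Pp Qp PQ; apply: contrapT => nz.
have QP : Q `<=` P by move=> z Qz; apply: contrapT => Pz; apply: nz; exists z.
apply: PQ; apply/seteqP; split=> // x Px; apply: contrapT => Qx.
have [b /QP Pb] := prime_inverse Qp Qx; have [PI P1 _ _] := prime_idealP Pp.
apply: P1; rewrite -[1](subKr (x * b)).
by case: (PI) => _ PB _; apply: PB => //; exact: ideal_mulr.
Qed.

(** Take the product of the squares of elements chosen in each [Q] and outside [P]. *)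
Lemma avoid_prime P (T : seq (set OK)) : nonzero_prime_ideal P ->
  (forall Q, Q \in T -> nonzero_prime_ideal Q) -> P \notin T ->
  exists2 y, ~ P y & forall Q, Q \in T -> ideal_exp Q 2 y.
Proof.
move=> Pp; elim: T => [|Q T IHT] Tp PT.
  by exists 1 => //; case: (prime_idealP Pp).
move: PT; rewrite inE negb_or => /andP[/eqP PQ PT].
have [|y Py yT] := IHT _ PT; first by move=> Q' QT; apply: Tp; rewrite inE QT orbT.
have Qp : nonzero_prime_ideal Q by apply: Tp; rewrite mem_head.
have [z Qz Pz] := prime_incomparable Pp Qp PQ.
have [_ _ Pm _] := prime_idealP Pp.
exists (y * (z * z)) => [/Pm[//|/Pm[]//]|Q']; rewrite inE => /predU1P[->|QT].
  have [QI _ _ _] := prime_idealP Qp.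
  by case: (is_ideal_exp 2 QI) => _ _; apply; exact: ideal_exp2M.
have /prime_idealP[QI _ _ _] : nonzero_prime_ideal Q'.
  by apply: Tp; rewrite inE QT orbT.
by apply: ideal_mulr; [exact: is_ideal_exp | exact: yT].
Qed.

(* Chinese remaindering, with classes mod [P ^ 2] written [r i + t * r j]
   for [t] in [P] but not in [P ^ 2]. *)
Lemma incongruent_prime_squares (T : seq (set OK)) : uniq T ->
  (forall P, P \in T -> nonzero_prime_ideal P /\
     exists2 t, P t & ~ ideal_exp P 2 t) ->
  exists (I : finType) (g : I -> OK),
    #|I| = (\prod_(P <- T) ideal_norm P ^ 2)%N /\
    forall i j, i != j -> exists2 P, P \in T & ~ ideal_exp P 2 (g i - g j).
Proof.
elim: T => [_ _|P T IHT /andP[PT uT] Tp].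
  exists unit, (fun=> 0); split; first by rewrite big_nil card_unit.
  by move=> [] [].
have [|I' [g' [I'c g'T]]] := IHT uT.
  by move=> Q QT; apply: Tp; rewrite inE QT orbT.
have [Pp [t Pt P2t]] := Tp P (mem_head _ _).
have [y Py yT] : exists2 y, ~ P y & forall Q, Q \in T -> ideal_exp Q 2 y.
  by apply: avoid_prime => // Q QT; have [] := Tp Q; rewrite ?inE ?QT ?orbT.
have [r [rI rS]] := prime_reps Pp; have [PI _ _ _] := prime_idealP Pp.
pose N := ideal_norm P.
(* The factor [y] lies in the square of every ideal of [T], so the added term does not disturb the
   classes already separated by [g']; modulo the square of [P] it is invertible. *)
exists (('I_N * 'I_N) * I')%type, (fun u => y * (r u.1.1 + t * r u.1.2) + g' u.2).
split; first by rewrite !card_prod card_ord I'c big_cons.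
move=> [[i j] k] [[i' j'] k'] ne /=.
have [ek|/g'T[Q QT Qk]] := eqVneq k k'; last first.
  exists Q; first by rewrite inE QT orbT.
  have /prime_idealP[QI _ _ _] : nonzero_prime_ideal Q.
    by have [] := Tp Q; rewrite ?inE ?QT ?orbT.
  set u := r i + _; set v := r i' + _ => Quv; apply: Qk.
  apply: (idealDr (is_ideal_exp 2 QI) (y := y * (u - v))).
    by apply: ideal_mulr; [exact: is_ideal_exp | exact: yT].
  by have -> : g' k - g' k' + y * (u - v) = y * u + g' k - (y * v + g' k') by ring.
exists P; first exact: mem_head.
rewrite ek opprD addrACA subrr addr0 -mulrBr => /(prime_exp2_cancel Pp Py) P2.
(* Reduction modulo [P] determines [i]; then [t * (r j - r j')] lies in the square of [P], and [t]
   does not, which determines [j]. *)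
have e : i = i'.
  apply: rI; apply: (idealDr PI (y := t * (r j - r j'))); first exact: ideal_mulr.
  have := ideal_exp_sub PI (isT : (1 <= 2)%N) P2; rewrite ideal_exp1 //.
  by congr P; ring.
move: P2; rewrite e opprD addrACA subrr add0r -mulrBr mulrC.
move=> /(prime_exp2_cancel Pp) H; apply/P2t/H => /rI ej.
by move: ne; rewrite ek e ej eqxx.
Qed.

End Counting.

(** Elements incongruent modulo the square of some prime of [T] are incongruent modulo [a]. The
    Chinese remainder construction supplies as many as the squared product of norms, and
    [index_bound] limits their number. *)
Lemma prod_norm_bound (F : numClosedFieldType) (K : fieldExtType rat) :
  exists d (s : 'I_d -> {rmorphism K -> F}) (C : nat),
  [/\ injective (fun j => s j : K -> F),
      forall t : {rmorphism K -> F}, exists j, (t : K -> F) = s j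
    & forall (a : ring_of_integers K) (T : seq (set (ring_of_integers K))),
        a != 0 -> uniq T ->
        (forall P, P \in T -> [/\ nonzero_prime_ideal P, ideal_exp P 2 a &
           exists2 t, P t & ~ ideal_exp P 2 t]) ->
        (\prod_(P <- T) (ideal_norm P)%:R) ^+ 2
          <= C%:R * \prod_j `|s j (val a)| :> F].
Proof.
have [d [s [C [sI emb bd]]]] := index_bound F K.
exists d, s, C; split=> // a T a0 uT Tp.
have [|I [g [cI gT]]] := incongruent_prime_squares uT.
  by move=> P /Tp[].
have -> : (\prod_(P <- T) (ideal_norm P)%:R) ^+ 2 = #|I|%:R :> F.
  by rewrite cI -prodrXl natr_prod; apply: eq_bigr => P _; rewrite natrX.
apply: (bd a I g a0) => i j /gT[P PT nP] b e; apply: nP; rewrite e.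
have [Pp P2 _] := Tp P PT; have [PI _ _ _] := prime_idealP Pp.
by apply: ideal_mulr => //; exact: is_ideal_exp.
Qed.

(** * Height and radical *)

(** Finite support excludes the default value 1 of the product; the factors other than [f w] are
    then at least 1. *)
Lemma le_prod_fsbig (R : realType) (T : choiceType) (A : set T) (f : T -> R) w :
  (forall v, A v -> 1 <= f v) -> finite_set (A `&` f @^-1` [set~ 1]) -> A w ->
  f w <= \big[*%R/1]_(v \in A) f v.
Proof.
move=> f1 fin Aw.
have supp v : v \in finite_support 1 A f -> 1 <= f v.
  by rewrite in_finite_support // in_setE => -[/f1].
have ge1 (S : seq T) Q : {subset S <= finite_support 1 A f} ->
    1 <= \prod_(v <- S | Q v) f v.
  move=> sub; rewrite big_seq_cond; elim/big_ind: _ => // [x y|v /andP[/sub/supp]//].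
  exact: mulr_ege1.
have [fw|fw] := eqVneq (f w) 1; first by rewrite fw; exact: ge1.
have wS : w \in finite_support 1 A f.
  by rewrite in_finite_support // in_setE; split=> //; exact/eqP.
rewrite (bigD1_seq w wS (finite_support_uniq _ _ _)) /=.
by rewrite ler_peMr ?ge1 // (le_trans ler01) // f1.
Qed.

Section Height.
Variables (R : realType) (K : fieldExtType rat).
Local Notation OK := (ring_of_integers K).
Implicit Types (x : OK) (P : set OK).

Lemma normcX (z : R[i]) n : normc (z ^+ n) = normc z ^+ n.
Proof. by elim: n => [|n IHn]; rewrite ?normc1 // !exprS normcM IHn. Qed.

Lemma normc_ge0 (z : R[i]) : 0 <= normc z.
Proof. by case: z => a b; exact: sqrtr_ge0. Qed.

Lemma valuation1 P : nonzero_prime_ideal P -> valuation P 1 = 0%N.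
Proof.
move=> /prime_idealP[PI P1 _ _]; rewrite /valuation.
case: xgetP => // -[//|n] _ [/= + _]; rewrite in_setE.
move=> /(ideal_exp_sub PI (isT : (1 <= n.+1)%N)).
by rewrite ideal_exp1.
Qed.

Lemma finite_abs_le1 P x : finite_abs R P x <= 1.
Proof.
rewrite /finite_abs; case: ifP => // _; case: (ideal_norm P) => [|n].
  by case: (valuation P x) => [|k]; rewrite ?expr0 ?invr1 // expr0n invr0.
by rewrite invf_le1 ?exprn_gt0 ?ltr0n // exprn_ege1 // ler1n.
Qed.

Lemma finite_abs1 P : nonzero_prime_ideal P -> finite_abs R P 1 = 1.
Proof. by move=> Pp; rewrite /finite_abs oner_eq0 valuation1 // expr0 invr1. Qed.

(** Whichever of the two conjugate embeddings [xget] selects, the modulus is the same; [k] is 1 at a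
    real place and 2 at a complex one. *)
Lemma archimedean_absE (w : set (K -> R[i])) (s : {rmorphism K -> R[i]}) :
  w = [set (s : K -> R[i]); fun y => conjc (s y)] ->
  exists2 k, (0 < k)%N & forall x, archimedean_abs w x = normc (s (val x)) ^+ k.
Proof.
move=> wE; have : w (xget (fun=> 0) w).
  by apply: xgetPex; exists (s : K -> R[i]); rewrite wE; left.
have normJ z : normc (conjc z) = normc z by case: z => a b; rewrite /= sqrrN.
rewrite /archimedean_abs; move: (xget (fun=> 0) w) => t wt.
have tE y : normc (t y) = normc (s y) by move: wt; rewrite wE => -[] -> //.
pose k := if `[< forall y, complex.Im (t y) = 0 >] then 1%N else 2%N.
exists k; first by rewrite /k; case: ifP.
by move=> x; rewrite /k; case: ifP => _; rewrite tE.
Qed.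

Lemma finite_archimedean_places :
  finite_set [set w : set (K -> R[i]) | archimedean_place w].
Proof.
have [d [s [_ [_ emb _]]]] := prod_norm_bound R[i] K.
apply: (@sub_finite_set _ _ [set [set (s j : K -> R[i]); fun y => conjc (s j y)]%classic
  | j in [set: 'I_d]]); last exact: finite_image.
by move=> w [t ->]; have [j ->] := emb t; exists j.
Qed.

(** The middle entry 1 makes every local factor at least 1, and exactly 1 at finite places, so the
    product dominates its factor at the place of [s]. *)
Lemma le_height (a b : OK) (s : {rmorphism K -> R[i]}) :
  1 <= normc (s (val b)) ->
  normc (s (val b)) `^ (\dim {:K})%:R^-1 <= height R a 1 b.
Proof.
move=> s1; rewrite /height; set f := (fun v => Num.max _ _); set A := @places R K.
have dimge0 : 0 <= (\dim {:K})%:R^-1 :> R by rewrite invr_ge0 ler0n.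
have fin P : nonzero_prime_ideal P -> f (inl P) = 1.
  move=> Pp; rewrite /f /= finite_abs1 //; apply/le_anti.
  by rewrite !ge_max !le_max !finite_abs_le1 !lexx !orbT.
pose w : set (K -> R[i]) := [set (s : K -> R[i]); fun y => conjc (s y)].
have fw : normc (s (val b)) <= f (inr w).
  have [k k0 wE] := archimedean_absE (erefl w).
  rewrite /f /= !le_max !wE; apply/orP; right; apply/orP; right.
  by rewrite ler_eXnr.
have f1 v : A v -> 1 <= f v.
  case: v => [P /fin->//|v [t /archimedean_absE[k _ vE]]].
  by rewrite /f /= !le_max !vE rmorph1 normc1 expr1n lexx orbT.
have finA : finite_set (A `&` f @^-1` [set~ 1]).
  apply: (@sub_finite_set _ _ [set inr w | w in [set w | archimedean_place w]]).
    by move=> [P [/fin /= e []//]|v [/= Av _]]; exists v.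
  exact/finite_image/finite_archimedean_places.
have le : normc (s (val b)) <= \big[*%R/1]_(v \in A) f v.
  apply: (le_trans fw); apply: (le_prod_fsbig f1 finA); by exists s.
by apply: ge0_ler_powR => //; rewrite nnegrE ?(le_trans (normc_ge0 _) le) ?normc_ge0.
Qed.

End Height.

(** * The radical of [eta ^+ n - 1] *)

Lemma le_prod_uniq (R : realDomainType) (T : eqType) (f : T -> R) (S E : seq T) :
  (forall v, 1 <= f v) -> uniq S -> uniq E -> {subset S <= E} ->
  \prod_(v <- S) f v <= \prod_(v <- E) f v.
Proof.
move=> f1 uS uE SE.
have -> : \prod_(v <- S) f v = \prod_(v <- E | v \in S) f v.
  rewrite -[RHS]big_filter; apply: perm_big; apply: uniq_perm => //.
    exact: filter_uniq.
  by move=> v; rewrite mem_filter andb_idr // => /SE.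
rewrite [X in _ <= X](bigID (mem S)) /=.
have f0 v : 0 <= f v by exact: le_trans (f1 v).
rewrite ler_peMr ?prodr_ge0 //; elim/big_ind: _ => // x y; exact: mulr_ege1.
Qed.

(** The norm of [P] lies in [P], hence so does one of its prime factors. In the unramified case 1 is
    the only exponent meeting the specification of [valuation]. *)
Lemma prime_below_valuation (K : fieldExtType rat) (P : set (ring_of_integers K)) :
  nonzero_prime_ideal P -> exists p,
  [/\ prime p, P p%:R & ~ ideal_exp P 2 p%:R -> valuation P (prime_below P)%:R = 1%N].
Proof.
move=> Pp; have [PI P1 Pm _] := prime_idealP Pp.
have [r [rI rS]] := prime_reps Pp.
have PN := card_reps_in_ideal PI rI rS.
have N0 : (0 < ideal_norm P)%N.
  by have [[i iN] _] := rS 0; exact: leq_ltn_trans iN.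
have ex : exists p, prime p /\ P p%:R.
  elim/ltn_ind: (ideal_norm P) N0 PN => n IHn n0 Pn.
  have [n1|n1] := leqP n 1.
    by case: P1; move: Pn; have -> : n = 1%N by lia.
  have /dvdnP[m mE] := pdiv_dvd n; rewrite mE natrM in Pn.
  have pp := pdiv_prime n1.
  have [Pm'|Pp'] := Pm _ _ Pn; last by exists (pdiv n).
  apply: IHn Pm'; last by rewrite lt0n; apply: contraTneq n0 => m0; rewrite mE m0.
  by rewrite mE ltn_Pmulr ?prime_gt1 // lt0n; apply: contraTneq n0 => m0; rewrite mE m0.
have : [set p : nat | prime p /\ p%:R \in P] (prime_below P).
  by apply: xgetPex; have [p [pp Ppp]] := ex; exists p; split=> //; rewrite in_setE.
case=> pp; rewrite in_setE => Ppp; exists (prime_below P); split=> // nP2.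
have Pp1 : ideal_exp P 1 (prime_below P)%:R by rewrite ideal_exp1.
rewrite /valuation; move: (_%:R) nP2 Pp1 => x nP2 Pp1.
case: xgetP => [n _ [/=]|/(_ 1%N)].
  rewrite !in_setE notin_setE => Pn nPn.
  case: n Pn nPn => [|[|n]] // Pn nPn.
  by case: nP2; exact: (ideal_exp_sub PI (isT : (2 <= n.+2)%N)).
by case; split; rewrite ?in_setE ?notin_setE.
Qed.

(** The primes in the product are split into a finite exceptional set, contributing a bounded
    factor, and primes whose square contains [eta ^+ n - 1], controlled by [prod_norm_bound]. *)
Lemma radical_bound (R : realType) (K : fieldExtType rat)
    (eta : ring_of_integers K) :
  eta \is a GRing.unit ->
  finite_set [set P | nonzero_prime_ideal P /\ non_wieferich eta P] ->
  exists d (s : 'I_d -> {rmorphism K -> R[i]}) (C : R),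
  [/\ injective (fun j => s j : K -> R[i]), 0 <= C
    & forall n, (0 < n)%N -> eta ^+ n - 1 != 0 ->
      exists X, [/\ 0 <= X,
        radical R ((eta ^+ n - 1) * 1 * - eta ^+ n) = X `^ (\dim {:K})%:R^-1
        & X ^+ 2 <= C * \prod_j normc (s j (val (eta ^+ n - 1)))]].
Proof.
move=> eU finW; have [d [s [C [sI _ bd]]]] := prod_norm_bound R[i] K.
have [D D0 ram] := ramified_divides K.
have finD := finite_ideals_containing (_ : (D%:~R : ring_of_integers K) != 0).
have {}finD := finD (etrans (congr1 negb (intr_integer_eq0 K D)) D0).
(* The second set contains every ramified prime, by [ramified_divides]. *)
pose B := [set P | nonzero_prime_ideal P /\ non_wieferich eta P] `|`
  [set P : set (ring_of_integers K) | is_ideal P /\ P D%:~R].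
have finB : finite_set B by rewrite finite_setU.
pose f (P : set (ring_of_integers K)) : R :=
  (ideal_norm P)%:R ^+ valuation P (prime_below P)%:R.
have f0 P : 0 <= f P by rewrite exprn_ge0 ?ler0n.
(* The maximum with 1 makes the product over any part of [B] at most [CB], even though [B] may
   contain ideals that are not prime. *)
pose CB := \prod_(P <- fset_set B) Num.max 1 (f P).
exists d, s, (CB ^+ 2 * C%:R); split=> //.
  by rewrite mulr_ge0 ?sqr_ge0 ?ler0n.
move=> n n0 x0; set x := eta ^+ n - 1 in x0 *.
set A := [set P : set (ring_of_integers K) |
  nonzero_prime_ideal P /\ x * 1 * - eta ^+ n \in P].
exists (\big[*%R/1]_(P \in A) f P); split=> //.
  by elim/big_ind: _ => // y z; exact: mulr_ge0.
set S := finite_support 1 A f.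
(* On an infinite support the product has junk value [1] and [S] is empty. *)
have SA P : P \in S -> nonzero_prime_ideal P /\ P x.
  have [fin|inf] := pselect (finite_set (A `&` f @^-1` [set~ 1])); last first.
    by rewrite /S no_finite_support.
  rewrite in_finite_support // in_setE => -[[Pp]]; rewrite in_setE => Px _.
  split=> //; have [PI _ _ _] := prime_idealP Pp.
  have -> : x = x * 1 * - eta ^+ n * (- eta^-1 ^+ n).
    by rewrite mulr1 -mulrA mulrNN -exprMn divrr // expr1n mulr1.
  exact: ideal_mulr.
have uS : uniq S := finite_support_uniq _ _ _.
set Y := \prod_j normc _.
rewrite (bigID (mem (fset_set B))) /= exprMn -[X in _ <= X]mulrA -!(big_filter S).
set S1 := filter _ S; set S2 := filter _ S.
apply: ler_pM; rewrite ?sqr_ge0 //.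
  rewrite lerXn2r ?nnegrE ?prodr_ge0 // => [P _|]; first by rewrite le_max ler01.
  apply: (@le_trans _ _ (\prod_(P <- S1) Num.max 1 (f P))).
    by apply: ler_prod => P _; rewrite f0 le_max lexx orbT.
  apply: le_prod_uniq => [P|||P]; rewrite ?le_max ?lexx ?filter_uniq ?fset_uniq //.
  by rewrite mem_filter => /andP[].
(* Outside [B] the prime [P] is unramified, so [p] itself witnesses that [P] differs from its
   square, and the exponent in the radical is 1. *)
have S2P P : P \in S2 -> [/\ nonzero_prime_ideal P, ideal_exp P 2 x,
    exists2 t, P t & ~ ideal_exp P 2 t & f P = (ideal_norm P)%:R].
  rewrite mem_filter => /andP[PB /SA[Pp Px]].
  have nB : ~ B P by move: PB; rewrite in_fset_set // notin_setE.
  have [p [pp Pp1 val1]] := prime_below_valuation Pp.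
  have P2 : ~ ideal_exp P 2 p%:R.
    move=> P2; apply: nB; right; split; first by case: (prime_idealP Pp).
    exact: ram P2.
  split=> //; last by rewrite /f val1 // expr1.
    by apply: wieferich_exp2 => // nW; apply: nB; left.
  by exists p%:R.
have -> : \prod_(P <- S2) f P = \prod_(P <- S2) (ideal_norm P)%:R.
  by apply: eq_big_seq => P /S2P[].
have := bd x S2 x0 (filter_uniq _ uS)
  (fun P PS => let: And4 a b c _ := S2P P PS in And3 a b c).
rewrite -lecR /Y rmorphXn rmorphM rmorph_nat !rmorph_prod.
rewrite [X in X ^+ 2 <= _ -> _](_ : _ = \prod_(P <- S2) (ideal_norm P)%:R%:C%C) //.
by apply: eq_bigr => P _; rewrite (rmorph_nat (real_complex R)).
Qed.

(** * Boundedness of the powers of [sigma0 eta] and the contradiction *)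

Theorem theorem1p0p1 (R : realType) (K : fieldExtType rat)
    (eta : ring_of_integers K) (sigma0 : {rmorphism K -> R[i]}) :
  abc_conjecture R K ->
  eta \is a GRing.unit ->
  1 < normc (sigma0 (val eta)) ->
  (forall sigma : {rmorphism K -> R[i]},
     (sigma : K -> R[i]) <> sigma0 -> normc (sigma (val eta)) < 1) ->
  infinite_set
    [set P : set (ring_of_integers K) |
       nonzero_prime_ideal P /\ non_wieferich eta P].
Proof.
move=> abc eU b1 small fin; set b := normc (sigma0 (val eta)) in b1.
have b0 : 0 < b by exact: lt_trans b1.
have [d [s [C [sI C0 rad]]]] := radical_bound R eU fin.
have half0 : 0 < 2^-1 :> R by rewrite invr_gt0.
have [C1 abc1] := abc _ half0.
have normcD (y z : R[i]) : normc (y + z) <= normc y + normc z by exact: le_normcD.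
have normc1' : normc (1 : R[i]) = 1 := normc1 R.
have normcN' (z : R[i]) : normc (- z) = normc z by exact: normcN.
have valX n : val (eta ^+ n) = val eta ^+ n by rewrite rmorphXn.
have valE n : val (eta ^+ n - 1) = val eta ^+ n - 1.
  by rewrite rmorphB rmorph1 /= -valX.
have x0 n : (0 < n)%N -> eta ^+ n - 1 != 0.
  move=> n0; rewrite subr_eq0; apply/eqP => e.
  have : b ^+ n = 1 by rewrite -normcX -rmorphXn -valX e !rmorph1.
  by apply/eqP; rewrite gt_eqF // exprn_egt1 // -lt0n.
have prod_le n : \prod_j normc (s j (val (eta ^+ n - 1))) <= 2 ^+ d * b ^+ n.
  have bn : 1 <= b ^+ n by rewrite exprn_ege1 // ltW.
  (* The triangle inequality bounds each factor by [normc (s j (val eta)) ^+ n + 1]; both terms are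
     at most [b ^+ n] at [sigma0] and at most 1 elsewhere. *)
  have le j : normc (s j (val (eta ^+ n - 1))) <=
      2 * (if `[< (s j : K -> R[i]) = sigma0 >] then b ^+ n else 1).
    have : normc (s j (val (eta ^+ n - 1))) <= normc (s j (val eta)) ^+ n + 1.
      by rewrite valE rmorphB rmorph1 rmorphXn
         -normcX -[X in _ <= _ + X]normc1' -[X in _ <= _ + X]normcN'.
    move/le_trans; apply; case: asboolP => [->|/small lt1].
      by rewrite -/b; lra.
    have : normc (s j (val eta)) ^+ n <= 1 by rewrite exprn_ile1 ?normc_ge0 // ltW.
    by lra.
  pose h j := if `[< (s j : K -> R[i]) = sigma0 >] then b ^+ n else 1.
  apply: (@le_trans _ _ (\prod_j (2 * h j))).
    by apply: ler_prod => j _; rewrite normc_ge0; exact: le.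
  rewrite big_split /= prodr_const card_ord ler_pM2l ?exprn_gt0 //.
  (* Since [s] is injective, at most one index contributes [b ^+ n]. *)
  have [[j0 j0E]|none] := pselect (exists j, (s j : K -> R[i]) = sigma0).
    rewrite (bigD1 j0) //= {1}/h asboolT // big1 ?mulr1 // => j jj0.
    by rewrite /h asboolF // => jE; move/eqP: jj0; apply; apply: sI; rewrite jE.
  by rewrite big1 // => j _; rewrite /h asboolF // => jE; apply: none; exists j.
pose m := \dim {:K}.
have m0 : (0 < m)%N := adim_gt0 _.
(* Raised to the power [4 * m], abc reads [b ^+ n ^+ 4 <= C1 ^+ (4 * m) * X ^+ 6], where
   [X ^+ 2 <= C * 2 ^+ d * b ^+ n]; cancelling three factors [b ^+ n] leaves this constant. *)
pose M := C1 ^+ (4 * m) * (C * 2 ^+ d) ^+ 3.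
have bM n : (0 < n)%N -> b ^+ n <= M.
  move=> n0; have [X [X0 rE X2]] := rad n n0 (x0 n n0).
  have en0 : - eta ^+ n != 0.
    have : eta ^+ n \is a GRing.unit by rewrite unitrX.
    by rewrite oppr_eq0; apply: contraTneq => ->; rewrite unitr0.
  have sum0 : eta ^+ n - 1 + 1 + - eta ^+ n = 0 by rewrite subrK subrr.
  have := abc1 _ _ _ (x0 n n0) (oner_neq0 _) en0 sum0.
  have hE : normc (sigma0 (val (- eta ^+ n))) = b ^+ n.
    have -> : val (- eta ^+ n) = - val eta ^+ n by rewrite -valX rmorphN.
    by rewrite rmorphN normcN' rmorphXn normcX.
  have := @le_height R K (eta ^+ n - 1) (- eta ^+ n) sigma0.
  rewrite hE exprn_ege1 ?(ltW b1) // => /(_ isT) h1 h2.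
  have {h1 h2} := le_trans h1 h2; rewrite rE -/m -powRrM => le.
  have bn0 : 0 <= b ^+ n by rewrite exprn_ge0 // ltW.
  have mR : (m%:R : R) != 0 by rewrite pnatr_eq0 -lt0n.
  (* The power [4 * m] clears the fractional exponents. *)
  have L : ((b ^+ n) `^ m%:R^-1) ^+ (4 * m) = b ^+ n ^+ 4.
    rewrite -powR_mulrn ?powR_ge0 // -powRrM natrM mulrCA mulVf // mulr1.
    by rewrite powR_mulrn.
  have Rr : (X `^ (m%:R^-1 * (1 + 2^-1))) ^+ (4 * m) = X ^+ 2 ^+ 3.
    rewrite -powR_mulrn ?powR_ge0 // -powRrM.
    have -> : m%:R^-1 * (1 + 2^-1) * (4 * m)%:R = 6%:R :> R.
      by rewrite natrM; field.
    by rewrite powR_mulrn // -exprM.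
  have : (b ^+ n) ^+ 4 <= M * (b ^+ n) ^+ 3.
    have lhs0 : 0 <= (b ^+ n) `^ m%:R^-1 by exact: powR_ge0.
    have : ((b ^+ n) `^ m%:R^-1) ^+ (4 * m) <=
           (C1 * X `^ (m%:R^-1 * (1 + 2^-1))) ^+ (4 * m).
      by rewrite lerXn2r // nnegrE // (le_trans lhs0 le).
    rewrite exprMn L Rr => /le_trans; apply.
    rewrite /M -mulrA -exprMn ler_wpM2l //; first by rewrite mulnC exprM exprn_even_ge0.
    rewrite lerXn2r ?nnegrE ?sqr_ge0 //; first by rewrite !mulr_ge0 // exprn_ge0.
    by rewrite (le_trans X2) // -mulrA ler_wpM2l.
  by rewrite [_ ^+ 4]exprS ler_pM2r // !exprn_gt0.
(* Bernoulli's inequality makes [b ^+ n] exceed [M] for an explicit [n]. *)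
have bern n : 1 + n%:R * (b - 1) <= b ^+ n.
  elim: n => [|n IHn]; first by rewrite mul0r addr0.
  rewrite exprS -natr1; apply: le_trans (ler_wpM2l (ltW b0) IHn).
  rewrite -subr_ge0 (_ : _ - _ = n%:R * (b - 1) ^+ 2); last by ring.
  by rewrite mulr_ge0 ?ler0n ?sqr_ge0.
pose n := (Num.bound `|M / (b - 1)|).+1.
have Mn : M < n%:R * (b - 1).
  rewrite -ltr_pdivrMr ?subr_gt0 //; apply: (le_lt_trans (ler_norm _)).
  apply: (@lt_le_trans _ _ (Num.bound `|M / (b - 1)|)%:R); last by rewrite ler_nat.
  exact/archi_boundP/normr_ge0.
have n0 : (0 < n)%N by [].
have /lt_le_trans/(_ (bM n n0)) : M < b ^+ n.
  by apply: (lt_le_trans Mn); apply: le_trans (bern n); rewrite lerDr.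
by rewrite ltxx.
Qed.
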